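(* For integers $k\ge 0$ and $N\ge 1$ let $$W_{\Lambda^{k},N}(u_1,\ldots,u_k)=\mathrm{Coef}_{N+1}\left[\ln(1+zu_1+z^2u_2+\cdots+z^{k}u_k)\right]\in\mathbb{C}[u_1,\ldots,u_k].$$ Let $k\ge 1$ and $1\le j\le k$ be integers. Then there is an invertible (local holomorphic at the origin, fixing the origin) change of variables $(u_1,\ldots,u_k)\to(v_1,\ldots,v_k)$ on $\mathbb{C}^k$ such that $$W_{\Lambda^{k},2k-j}(u_1,\ldots,u_k)=W_{\Lambda^{k-j},2k-j}(v_1,\ldots,v_{k-j})+\frac{1}{2}\sum_{s=1}^{j}v_{k-j+s}\,v_{k+1-s}.$$
   Context: $\mathrm{Coef}_M[f(z)]$ denotes the coefficient of $z^M$ in the formal power series $f(z)$, and $\ln(1+x)=\sum_{n\ge1}(-1)^{n-1}x^n/n$. For $k=0$ the potential is $W_{\Lambda^0,N}=0$. *)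

(* Defs.v *)
(* Over the mathematical components libraries, with MathComp-Analysis. *)
From HB Require Import structures.
From mathcomp Require Import all_boot all_order all_algebra.
From mathcomp Require Import all_classical all_reals topology normedtype derive.
(* The notations of mpoly clash with those of MathComp-Analysis:
   [mpoly k C] below is {mpoly C[k]} and [mpolyX C (mnm1 i)] is 'X_i. *)
From mathcomp Require Import -(notations) mpoly.

Set Implicit Arguments.
Unset Strict Implicit.
Unset Printing Implicit Defensive.

Import Order.TTheory GRing.Theory Num.Theory numFieldNormedType.Exports.

Local Open Scope classical_set_scope.
Local Open Scope ring_scope.

(* Coef_M [ln (1 + f z)] for f with f 0 = 0 (the series does not make sense
   otherwise). Since f ^+ n has order at least n, only the terms n <= M of
   \sum_(n >= 1) (-1)^(n-1) f^n / n contribute: see coef_ln1p_stable. *)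
Definition coef_ln1p (F : fieldType) (A : comAlgType F) (M : nat)
    (f : {poly A}) : A :=
  \sum_(1 <= n < M.+1) ((-1) ^+ n.-1 / n%:R : F) *: (f ^+ n)`_M.

Lemma coef_ln1p_stable (F : fieldType) (A : comAlgType F) (M m : nat)
    (f : {poly A}) : f`_0 = 0 -> (M <= m)%N ->
  \sum_(1 <= n < m.+1) ((-1) ^+ n.-1 / n%:R : F) *: (f ^+ n)`_M
    = coef_ln1p M f.
Proof.
move=> f0 leMm; rewrite (big_cat_nat (n := M.+1)) //= [X in _ + X]big_nat_cond.
rewrite [X in _ + X]big1 ?addr0// => n; rewrite andbT => /andP[ltMn _].
suff -> : (f ^+ n)`_M = 0 by rewrite scaler0.
have -> : f = drop_poly 1 f * 'X.
  rewrite -{1}(poly_take_drop 1 f) expr1 -[RHS]add0r; congr (_ + _).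
  by apply/polyP => i; rewrite coef_take_poly coef0; case: i.
by rewrite exprMn coefMXn ltMn.
Qed.

(* W_{Lambda^k, N} as an element of C[u_1, ..., u_k]; the variable of index
   i : 'I_k is u_{i+1}. *)
Definition Wpot (C : fieldType) (k N : nat) : mpoly k C :=
  coef_ln1p N.+1
    (\sum_(i < k) (mpolyX C (mnm1 i))%:P * 'X^(i.+1) : {poly mpoly k C}).

Lemma Wpot0 (C : fieldType) (N : nat) : Wpot C 0 N = 0.
Proof.
rewrite /Wpot /coef_ln1p big_ord0 big_nat_cond big1// => n.
by rewrite andbT => /andP[n0 _]; rewrite expr0n gtn_eqF// coef0 scaler0.
Qed.

(* The coordinate v_m of v = (v_1, ..., v_k), numbered from 1; only meaningful
   for 1 <= m <= k. *)
Definition coord1 (C : fieldType) (k : nat) (v : 'rV[C]_k) (m : nat) : C :=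
  if insub m.-1 is Some i then v 0 i else 0.

(* [differentiable] is Frechet differentiability over the scalar field C, hence
   complex differentiability when C is the field of complex numbers; on an open
   subset of C^k this is holomorphy. *)
Definition holomorphic_on (C : numFieldType) (k l : nat) (U : set 'rV[C]_k)
    (f : 'rV[C]_k -> 'rV[C]_l) : Prop :=
  open U /\ forall x, U x -> differentiable f x.

Definition biholomorphism (C : numFieldType) (k : nat) (U V : set 'rV[C]_k)
    (phi : 'rV[C]_k -> 'rV[C]_k) : Prop :=
  [/\ set_bij U V phi,
      holomorphic_on U phi &
      exists2 psi : 'rV[C]_k -> 'rV[C]_k,
        (forall u, U u -> psi (phi u) = u) & holomorphic_on V psi].

(* Main.v *)
Require Import Defs.
From HB Require Import structures.
From mathcomp Require Import all_boot all_order all_algebra.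
From mathcomp Require Import all_classical all_reals topology normedtype derive.
From mathcomp Require Import complex zify ring.
From mathcomp Require Import -(notations) mpoly.

Set Implicit Arguments.
Unset Strict Implicit.
Unset Printing Implicit Defensive.

Import Order.TTheory GRing.Theory Num.Theory numFieldNormedType.Exports.

Local Open Scope classical_set_scope.
Local Open Scope ring_scope.

(* Let n = k - j, let M = n + k + 1 be the weight of the potential, m the
   largest integer below M / 2, and U = 1 + z u_1 + ... + z^k u_k. Let
   T = 1 + t_1 z + ... + t_m z^m be the truncation of 1 / U, so that
   T U = 1 + q z^(m+1) + ..., and ln U = - ln T + ln (T U). By degree reasons
     Coef_M [ln (T U)] = \sum_(n < i <= m) t_i u_(M-i) - q^2 / 2,
   the last term being present only for M = 2 (m + 1). Moreover
     Coef_M [ln T] = Coef_M [ln (1 + t_1 z + ... + t_n z^n)]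
                     + \sum_(n < i <= m) t_i G_i (t)
   for polynomials G_i. Hence the wanted coordinates are v_i = zeta^i t_i for
   i <= n, where zeta^M = -1; v_i = t_i and v_(M-i) = u_(M-i) - G_i (t) for
   n < i <= m; and sqrt(-1) q at the index M / 2. As t depends only on
   u_1, ..., u_m and u |-> t is an involution, while q - u_(m+1) is a
   polynomial in u_1, ..., u_m, this is a polynomial automorphism of C^k, and
   no inverse function theorem is needed. *)

(** * Coefficients of logarithms and truncated reciprocals *)

Section LogCoefficients.
Variable C : numFieldType.
Implicit Types (f g I J e : {poly C}) (x y t : nat -> C).

(** The scalar counterpart of [coef_ln1p]: values of the potential at points of C^k take this
    form. *)
Definition log_coef (M : nat) (f : {poly C}) : C :=
  \sum_(1 <= n < M.+1) (-1) ^+ n.-1 / n%:R * (f ^+ n)`_M.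

(** The truncated geometric series, an inverse of [1 + f] modulo ['X^(m.+1)] when [f] has no
    constant term. *)
Definition trunc_inv (m : nat) (f : {poly C}) : {poly C} :=
  \sum_(l < m.+1) (- f) ^+ l.

Lemma poly0_factorX f : f`_0 = 0 -> f = 'X * drop_poly 1 f.
Proof.
move=> f0; apply/polyP => i; rewrite coefXM coef_drop_poly.
by case: i => [|i] /=; rewrite ?f0 ?addn1.
Qed.

Lemma trunc_invP m f : f`_0 = 0 ->
  exists e, (1 + f) * trunc_inv m f = 1 + 'X^(m.+1) * e.
Proof.
move=> f0; exists (- (- drop_poly 1 f) ^+ m.+1).
have := subrX1 (- f) m.+1; rewrite -/(trunc_inv m f).
rewrite {1}(poly0_factorX f0) -mulrN exprMn => E.
have -> : (1 + f) * trunc_inv m f = - ((- f - 1) * trunc_inv m f) by ring.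
rewrite -E; ring.
Qed.

Lemma inv_mod_unique m f I J e e' :
  (1 + f) * I = 1 + 'X^m * e -> (1 + f) * J = 1 + 'X^m * e' ->
  exists e'', I = J + 'X^m * e''.
Proof.
move=> EI EJ; exists (J * e - I * e').
have : I * ((1 + f) * J) = J * ((1 + f) * I) by ring.
rewrite EI EJ => E.
transitivity (I * (1 + 'X^m * e') - 'X^m * (I * e')); first by ring.
by rewrite E; ring.
Qed.

(* [(M+1) log_coef (M+1) f] is a coefficient of the logarithmic derivative
   [f' / (1 + f)], whose numerator and denominator are multiplicative. *)
Lemma log_coef_deriv M f I e : f`_0 = 0 -> (1 + f) * I = 1 + 'X^(M.+1) * e ->
  M.+1%:R * log_coef M.+1 f = (f^`() * I)`_M.
Proof.
move=> f0 EI; have [e1 EJ] := trunc_invP M f0.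
(* Any inverse modulo ['X^(M.+1)] may be replaced by the geometric series: the difference does not
   reach degree [M]. *)
have [e2 ->] := inv_mod_unique EI EJ.
rewrite mulrDr [f^`() * ('X^_ * _)]mulrCA coefD coefXnM ltnSn addr0.
rewrite /log_coef big_add1 /= big_mkord mulr_sumr /trunc_inv mulr_sumr coef_sum.
apply: eq_bigr => l _.
have -> : M.+1%:R * ((-1) ^+ l / l.+1%:R * (f ^+ l.+1)`_M.+1)
   = (-1) ^+ l / l.+1%:R * ((f ^+ l.+1)^`())`_M.
  by rewrite coef_deriv -mulr_natl; ring.
rewrite deriv_exp coefMn -[X in _ * X = _]mulr_natl mulrA mulfVK ?pnatr_eq0//=.
have -> : (- f) ^+ l = ((-1) ^+ l)%:P * f ^+ l.
  by rewrite [LHS]exprNn polyC_exp polyCN.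
by rewrite mulrCA coefCM.
Qed.

(** Logarithmic derivatives of products add, and the product of the truncated inverses inverts the
    product; the factor [M.+1] then cancels in characteristic zero. *)
Lemma log_coefM M f g : f`_0 = 0 -> g`_0 = 0 ->
  log_coef M.+1 ((1 + f) * (1 + g) - 1) = log_coef M.+1 f + log_coef M.+1 g.
Proof.
move=> f0 g0; set h := _ - 1.
have h0 : h`_0 = 0.
  by rewrite coefB coef0M !coefD !coef1 f0 g0 /= !addr0 mulr1 subrr.
have [e1 Ef] := trunc_invP M f0; have [e2 Eg] := trunc_invP M g0.
set I := trunc_inv M f in Ef; set J := trunc_inv M g in Eg.
have Eh : (1 + h) * (I * J) = 1 + 'X^(M.+1) * (e1 + e2 + 'X^(M.+1) * e1 * e2).
  have -> : (1 + h) * (I * J) = ((1 + f) * I) * ((1 + g) * J) by rewrite /h; ring.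
  rewrite Ef Eg; ring.
apply: (mulfI (x := M.+1%:R)); first by rewrite pnatr_eq0.
rewrite mulrDr (log_coef_deriv h0 Eh) (log_coef_deriv f0 Ef) (log_coef_deriv g0 Eg).
have -> : h^`() * (I * J) =
    f^`() * I * ((1 + g) * J) + g^`() * J * ((1 + f) * I).
  rewrite /h derivB derivM !derivD -!polyC1 !derivC; ring.
rewrite Ef Eg.
have -> : f^`() * I * (1 + 'X^(M.+1) * e2) + g^`() * J * (1 + 'X^(M.+1) * e1) =
  f^`() * I + g^`() * J + 'X^(M.+1) * (f^`() * I * e2 + g^`() * J * e1) by ring.
by rewrite !coefD coefXnM ltnSn addr0.
Qed.

(** The [n]-th power has order at least [n * m.+1]. This exceeds [M.+2] for [n >= 3], and the square
    reaches degree [M.+2] only when [M = m.*2]. *)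
Lemma log_coef_high_order M m e : (M <= m.*2)%N ->
  log_coef M.+2 ('X^(m.+1) * e) =
    ('X^(m.+1) * e)`_M.+2 - 2^-1 * (e`_0 ^+ 2 *+ (M == m.*2)).
Proof.
move=> leM; rewrite /log_coef big_ltn// big_ltn// [X in _ + (_ + X)]big_nat_cond.
rewrite [X in _ + (_ + X)]big1 => [|n]; last first.
  rewrite andbT => /andP[n2 _]; rewrite exprMn -exprM coefXnM.
  by rewrite ifT ?mulr0//; nia.
rewrite addr0 /= expr0 expr1 divr1 mul1r expr1; congr (_ + _).
rewrite exprMn -exprM coefXnM mulN1r mulNr; congr (- (_ * _)).
rewrite muln2 doubleS !ltnS; case: (eqVneq M m.*2) => [->|neM].
  by rewrite ltnn subnn mulr1n !expr2 coef0M.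
by rewrite ltn_neqAle neM leM mulr0n.
Qed.

Lemma comp_scale_coef (c : C) f i : (f \Po (c *: 'X))`_i = c ^+ i * f`_i.
Proof.
rewrite coef_comp_poly.
under eq_bigr do rewrite exprZn coefZ coefXn.
have [lti|lei] := ltnP i (size f).
  rewrite (bigD1 (Ordinal lti)) //= eqxx mulr1 big1 ?addr0 1?mulrC// => l.
  by rewrite -val_eqE /= eq_sym => /negbTE ->; rewrite !mulr0.
rewrite [f`_i]nth_default// mulr0 big1// => l _.
by rewrite gtn_eqF ?mulr0// (leq_trans _ lei).
Qed.

(** For [c ^+ M = -1], this absorbs the sign of - ln T into a rescaling of the variables. *)
Lemma log_coef_scale M (c : C) f :
  log_coef M (f \Po (c *: 'X)) = c ^+ M * log_coef M f.
Proof.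
rewrite /log_coef mulr_sumr; apply: eq_bigr => n _.
by rewrite -rmorphXn /= comp_scale_coef mulrCA.
Qed.

(** Variables are numbered from 1; the entry of [x] at 0 is discarded, so that ln (1 + f) makes
    sense. *)
Definition gen_poly (n : nat) (x : nat -> C) : {poly C} :=
  \poly_(i < n.+1) (if i == 0 then 0 else x i).

Lemma gen_poly0 n x : (gen_poly n x)`_0 = 0.
Proof. by rewrite coef_poly. Qed.

Lemma coef_gen_poly n x i :
  (gen_poly n x)`_i = if (0 < i <= n)%N then x i else 0.
Proof. by rewrite coef_poly ltnS lt0n; case: eqP; case: leqP. Qed.

Lemma eq_gen_poly n x y : (forall i, (0 < i <= n)%N -> x i = y i) ->
  gen_poly n x = gen_poly n y.
Proof.
move=> E; apply/polyP => i; rewrite !coef_gen_poly.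
by case: ifP => // /E.
Qed.

Lemma gen_polyS n x : gen_poly n.+1 x = gen_poly n x + x n.+1 *: 'X^(n.+1).
Proof.
apply/polyP => i; rewrite coefD coefZ coefXn !coef_gen_poly.
have [->|ne] := eqVneq i n.+1; first by rewrite ltnn leqnn mulr1 add0r.
by rewrite [(i <= n.+1)%N]leq_eqVlt (negbTE ne) ltnS mulr0 addr0.
Qed.

(* The quotient [(log_coef M (f + c X^i) - log_coef M f) / c], written as a
   polynomial expression so that it makes sense for [c = 0]. *)
Definition log_quot (M i : nat) (c : C) (f : {poly C}) : C :=
  \sum_(1 <= n < M.+1) (-1) ^+ n.-1 / n%:R *
    ('X^i * \sum_(l < n) (f + c *: 'X^i) ^+ (n.-1 - l) * f ^+ l)`_M.

Lemma log_quotP M i c f :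
  log_coef M (f + c *: 'X^i) = log_coef M f + c * log_quot M i c f.
Proof.
rewrite /log_coef mulr_sumr -big_split /=; apply: eq_bigr => n _.
have := subrXX (f + c *: 'X^i) f n; set S := \sum_(l < n) _.
rewrite [X in X * S](_ : _ = c *: 'X^i); last by rewrite addrAC subrr add0r.
rewrite -scalerAl => /(canRL (subrK _)) ->.
by rewrite coefD coefZ mulrDr addrC mulrCA.
Qed.

(** The monomials are adjoined one at a time. The factor of [x i] is the G_i of the header; it
    involves only [x 1], ..., [x i]. *)
Lemma log_coef_gen_poly M n m x : (n <= m)%N ->
  log_coef M (gen_poly m x) = log_coef M (gen_poly n x) +
    \sum_(n.+1 <= i < m.+1) x i * log_quot M i (x i) (gen_poly i.-1 x).
Proof.
elim: m => [|m IH]; first by rewrite leqn0 => /eqP->; rewrite big_geq ?addr0.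
rewrite leq_eqVlt => /orP[/eqP->|]; first by rewrite big_geq ?addr0.
by rewrite ltnS => len; rewrite big_nat_recr //= addrA -IH// gen_polyS log_quotP.
Qed.

(** Only [n = 1] survives, and it contributes the coefficient of degree [M] in ['X^i]. Hence the G_i
    vanish at the origin. *)
Lemma log_quot0 M i : (i < M)%N -> log_quot M i 0 0 = 0.
Proof.
move=> ltM; rewrite /log_quot big_nat_cond big1// => n; rewrite andbT.
move=> /andP[n0 _]; rewrite scale0r addr0.
have -> : \sum_(l < n) (0 : {poly C}) ^+ (n.-1 - l) * 0 ^+ l = (n == 1%N)%:R.
  under eq_bigr => l _.
    rewrite -exprD subnK ?expr0n; last by rewrite -ltnS prednK// ltn_ord.
    over.
  rewrite sumr_const card_ord; case: n n0 => [|[|n]]//= _.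
  by rewrite mul0rn.
rewrite -[X in 'X^i * X]polyC_natr coefMC coefXn gtn_eqF// mul0r mulr0//.
Qed.

(** The t_i of the header, for [0 < i <= m]. *)
Definition rec_coef (m : nat) (x : nat -> C) (i : nat) : C :=
  (trunc_inv m (gen_poly m x))`_i.

Lemma eq_rec_coef m x y : (forall i, (0 < i <= m)%N -> x i = y i) ->
  rec_coef m x = rec_coef m y.
Proof. by rewrite /rec_coef => /eq_gen_poly ->. Qed.

Lemma eq_mod_coef m f g e : f = g + 'X^(m.+1) * e ->
  forall i, (i <= m)%N -> f`_i = g`_i.
Proof. by move=> -> i lei; rewrite coefD coefXnM ltnS lei addr0. Qed.

Lemma coef_eq_mod m f g : (forall i, (i <= m)%N -> f`_i = g`_i) ->
  exists e, f = g + 'X^(m.+1) * e.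
Proof.
move=> E; exists (drop_poly m.+1 (f - g)); rewrite mulrC.
have /= := poly_take_drop m.+1 (f - g); set d := drop_poly _ _ => Ed.
suff E0 : take_poly m.+1 (f - g) = 0 by rewrite E0 add0r in Ed; rewrite Ed addrC subrK.
apply/polyP => i; rewrite coef_take_poly coef0 ltnS coefB.
by case: leqP => // /E ->; rewrite subrr.
Qed.

Lemma trunc_inv_coef0 m f : f`_0 = 0 -> (trunc_inv m f)`_0 = 1.
Proof.
move=> f0; have [e /(congr1 (fun p : {poly C} => p`_0))] := trunc_invP m f0.
by rewrite coef0M !coefD coefXnM f0 coef1 /= !addr0 mul1r.
Qed.

Lemma rec_coefP m n x : (m <= n)%N ->
  exists e, (1 + gen_poly m (rec_coef m x)) * (1 + gen_poly n x) = 1 + 'X^(m.+1) * e.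
Proof.
move=> len.
have [e1 E1] : exists e, 1 + gen_poly m (rec_coef m x) =
    trunc_inv m (gen_poly m x) + 'X^(m.+1) * e.
  apply: coef_eq_mod => -[|i] lei; rewrite coefD coef1 coef_gen_poly /=.
    by rewrite addr0 trunc_inv_coef0// gen_poly0.
  by rewrite lei add0r.
(* The variables beyond [m] affect the product only from degree [m.+1] on. *)
have [e2 E2] : exists e, 1 + gen_poly n x = 1 + gen_poly m x + 'X^(m.+1) * e.
  apply: coef_eq_mod => i lei; rewrite !coefD !coef_gen_poly.
  by rewrite lei (leq_trans lei).
have [e3 E3] := trunc_invP m (gen_poly0 m x).
rewrite E1 E2; set a := trunc_inv _ _ in E1 E3 *.
exists (e3 + a * e2 + e1 * (1 + gen_poly m x + 'X^(m.+1) * e2)).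
have -> : (a + 'X^(m.+1) * e1) * (1 + gen_poly m x + 'X^(m.+1) * e2) =
  (1 + gen_poly m x) * a + 'X^(m.+1) * (a * e2 + e1 * (1 + gen_poly m x + 'X^(m.+1) * e2)).
  ring.
rewrite E3; ring.
Qed.

(** Both sides are coefficients of inverses of T modulo ['X^(m.+1)], and such an inverse is unique
    up to that order. *)
Lemma rec_coefK m x i : (0 < i <= m)%N -> rec_coef m (rec_coef m x) i = x i.
Proof.
case/andP => i0 lei; have [e E] := rec_coefP x (leqnn m).
have [e1 E1] := trunc_invP m (gen_poly0 m (rec_coef m x)).
have [e2 E2] := inv_mod_unique E1 E.
rewrite /rec_coef (eq_mod_coef E2 lei) coefD coef1 coef_gen_poly i0 lei.
by rewrite gtn_eqF// add0r.
Qed.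

Lemma rec_coef_0 m i : (0 < i)%N -> rec_coef m (fun=> 0) i = 0.
Proof.
move=> i0; rewrite /rec_coef.
have -> : gen_poly m (fun=> 0) = 0.
  by apply/polyP => l; rewrite coef_gen_poly coef0 if_same.
by rewrite /trunc_inv big_ord_recl big1 ?addr0 ?coef1 ?gtn_eqF// => l _;
   rewrite oppr0 expr0n.
Qed.

End LogCoefficients.

(** * The change of coordinates and its inverse *)

Section NormalForm.
Variables (C : numClosedFieldType) (n k : nat) (zeta : C).
Hypotheses (lt_nk : (n < k)%N) (zetaM : zeta ^+ (n + k).+1 = -1).
Implicit Types (x y v w t : nat -> C).

(* m in the notation of the header, where M is [(n + k).+1] *)
Let half := (n + k)./2.

(** The index M / 2, which is paired with itself; it exists only when M is even, that is, [n + k]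
    odd. *)
Definition middle (i : nat) : bool := odd (n + k) && (i == half.+1).

(** The powers of [zeta] change the sign of the ln T part, and ['i] changes that of the square of
    q. *)
Definition coord_scale (i : nat) : C :=
  if (i <= n)%N then zeta ^+ i else if middle i then 'i else 1.

(** Meant for [half < i <= k]. At the middle index it is q minus [x half.+1]; elsewhere it is - G_l
    for the partner l = M - i, and l is at most [half]. In both cases only [x 1], ..., [x half]
    enter. *)
Definition coord_shift x (i : nat) : C :=
  let t := rec_coef half x in
  if middle i then ((1 + gen_poly half t) * (1 + gen_poly half x))`_i
  else let l := ((n + k).+1 - i)%N in
    - log_quot (n + k).+1 l (t l) (gen_poly l.-1 t).

Definition normal_coord x (i : nat) : C :=
  coord_scale i *
    (if (i <= half)%N then rec_coef half x i else x i + coord_shift x i).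

Definition normal_coord_inv v (i : nat) : C :=
  let y := rec_coef half (fun l => v l / coord_scale l) in
  if (i <= half)%N then y i else v i / coord_scale i - coord_shift y i.

Lemma half_facts : [/\ (n <= half)%N, (half < k)%N,
  odd (n + k) -> (n + k = half.*2.+1)%N & ~~ odd (n + k) -> (n + k = half.*2)%N].
Proof.
by have := odd_double_half (n + k); rewrite -/half; case: odd; split=> //; lia.
Qed.

Lemma coord_scale_neq0 i : coord_scale i != 0.
Proof.
rewrite /coord_scale; case: ifP => _.
  rewrite expf_eq0; apply/negP => /andP[_ /eqP z0].
  by move/eqP: zetaM; rewrite z0 expr0n eq_sym oppr_eq0 oner_eq0.
by case: ifP => _; rewrite ?neq0Ci ?oner_eq0.
Qed.

Lemma eq_coord_shift x y i : (forall l, (0 < l <= half)%N -> x l = y l) ->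
  coord_shift x i = coord_shift y i.
Proof. by move=> E; rewrite /coord_shift (eq_rec_coef E) (eq_gen_poly E). Qed.

(** Only the entries 1 to [k] matter, so the map on sequences descends to C^k. *)
Lemma eq_normal_coord x y : (forall l, (0 < l <= k)%N -> x l = y l) ->
  forall i, (0 < i <= k)%N -> normal_coord x i = normal_coord y i.
Proof.
move=> E i ik; have [_ hk _ _] := half_facts.
have E' l : (0 < l <= half)%N -> x l = y l by move=> ?; apply: E; lia.
by rewrite /normal_coord (eq_rec_coef E') (eq_coord_shift _ E') E.
Qed.

Lemma eq_normal_coord_inv v w : (forall l, (0 < l <= k)%N -> v l = w l) ->
  forall i, (0 < i <= k)%N -> normal_coord_inv v i = normal_coord_inv w i.
Proof.
move=> E i ik; have [_ hk _ _] := half_facts.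
have E' l : (0 < l <= half)%N -> v l / coord_scale l = w l / coord_scale l.
  by move=> ?; rewrite E//; lia.
by rewrite /normal_coord_inv (eq_rec_coef E') E.
Qed.

(** The map is triangular: the involution [rec_coef] recovers the entries up to [half], and these
    determine the shifts of the others. *)
Lemma normal_coordK x i : (0 < i)%N ->
  normal_coord_inv (normal_coord x) i = x i.
Proof.
move=> i0; rewrite /normal_coord_inv /normal_coord.
have E l : (0 < l <= half)%N -> rec_coef half (fun l => coord_scale l *
   (if (l <= half)%N then rec_coef half x l else x l + coord_shift x l) /
    coord_scale l) l = x l.
  move=> lh; rewrite (eq_rec_coef (y := rec_coef half x)) ?rec_coefK// => a ah.
  by case/andP: ah => _ ->; rewrite mulrAC divff ?mul1r ?coord_scale_neq0.
case: leqP => lei; first by rewrite E// i0.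
by rewrite (eq_coord_shift _ E) mulrAC divff ?coord_scale_neq0// mul1r addrK.
Qed.

Lemma normal_coord_invK v i : (0 < i)%N ->
  normal_coord (normal_coord_inv v) i = v i.
Proof.
move=> i0; rewrite /normal_coord.
pose y := rec_coef half (fun l => v l / coord_scale l).
have E l : (0 < l <= half)%N -> normal_coord_inv v l = y l.
  by rewrite /normal_coord_inv => /andP[_ ->].
rewrite (eq_rec_coef E) (eq_coord_shift _ E).
case: (leqP i half) => lei.
  by rewrite rec_coefK ?i0// mulrC mulfVK ?coord_scale_neq0.
rewrite /normal_coord_inv leqNgt lei /= subrK mulrC mulfVK ?coord_scale_neq0//.
Qed.

(** * The potential in the new coordinates *)

Lemma sum_pair (F : nat -> C) : (forall i, (i <= k)%N -> F ((n + k).+1 - i)%N = F i) ->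
  \sum_(n.+1 <= i < k.+1) F i =
  (\sum_(n.+1 <= i < half.+1) F i) *+ 2 + F half.+1 *+ odd (n + k).
Proof.
move=> Fsym; have [nh hk ho he] := half_facts.
rewrite (big_cat_nat (n := half.+1)) //=; last by lia.
rewrite mulr2n -addrA; congr (_ + _).
(* The reflection i -> M - i carries the lower half of the range onto the upper half. *)
have -> : \sum_(n.+1 <= i < half.+1) F i =
    \sum_((n + k).+1 - half <= i < k.+1) F i.
  have -> : ((n + k).+1 - half = n.+1 + (k - half))%N by lia.
  rewrite big_addn big_nat_rev /=.
  have -> : (k.+1 - (k - half) = half.+1)%N by lia.
  by apply: eq_big_nat => i ih; rewrite -[LHS]Fsym; [congr F; lia | lia].
case: (boolP (odd (n + k))) => od.
  have -> : ((n + k).+1 - half = half.+2)%N by move: (ho od); lia.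
  rewrite mulr1n big_ltn 1?addrC //.
rewrite mulr0n addr0.
by have -> : ((n + k).+1 - half = half.+1)%N by move: (he od); lia.
Qed.

Lemma log_coef_normal_form x :
  log_coef (n + k).+1 (gen_poly k x) =
    log_coef (n + k).+1 (gen_poly n (normal_coord x)) +
    2^-1 * \sum_(n.+1 <= i < k.+1)
      normal_coord x i * normal_coord x ((n + k).+1 - i)%N.
Proof.
have [nh hk ho he] := half_facts.
set M := (n + k).+1; set t := rec_coef half x.
set T := 1 + gen_poly half t; set U := 1 + gen_poly k x.
have [e TU] : exists e, T * U = 1 + 'X^(half.+1) * e by apply: rec_coefP; lia.
have TUc i : (0 < i)%N -> (T * U)`_i = ('X^(half.+1) * e)`_i.
  by move=> i0; rewrite TU coefD coef1 gtn_eqF// add0r.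
have low : log_coef M (gen_poly n (normal_coord x)) = - log_coef M (gen_poly n t).
  rewrite -mulN1r -zetaM -/M -log_coef_scale; congr log_coef.
  apply/polyP => i; rewrite comp_scale_coef !coef_gen_poly.
  case: ifP => [/andP[_ lein]|]; last by rewrite mulr0.
  by rewrite /normal_coord /coord_scale lein (leq_trans lein nh).
(* This is ln (T U) = ln T + ln U in degree M, with ln T split at [n]. *)
have := log_coefM (n + k) (gen_poly0 half t) (gen_poly0 k x).
rewrite -/T -/U TU -/M [1 + _]addrC addrK (log_coef_gen_poly _ _ nh).
have -> : log_coef M ('X^(half.+1) * e) =
    (T * U)`_M - 2^-1 * ((T * U)`_half.+1 ^+ 2 *+ odd (n + k)).
  (* [log_coef_high_order] needs M of the form [p.+2], which holds because [n < k]. *)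
  have [p Ep] : exists p, (n + k)%N = p.+1 by exists (n + k).-1; lia.
  rewrite /M Ep log_coef_high_order; last first.
    by case: (boolP (odd (n + k))) => [/ho|/he]; lia.
  rewrite -Ep TUc// (TUc half.+1)// (coefXnM half.+1 e half.+1) ltnn subnn.
  congr (_ - _ * (_ *+ _)); case: (boolP (odd (n + k))) => od.
    by apply/eqP; rewrite eqb1; apply/eqP; move: (ho od); lia.
  by apply/eqP; rewrite eqb0; apply/eqP; move: (he od); lia.
(* In the convolution, [i <= n] forces M - i > k, where U vanishes, and T vanishes for
   [i > half]. *)
have -> : (T * U)`_M = \sum_(n.+1 <= i < half.+1) t i * x (M - i)%N.
  rewrite coefM -(big_mkord xpredT (fun i => T`_i * U`_(M - i))).
  rewrite (big_cat_nat (n := n.+1)) //=; last by lia.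
  rewrite [X in X + _]big_nat_cond [X in X + _]big1 ?add0r => [|i]; last first.
    rewrite andbT => /andP[_ lei]; rewrite [U`__]coefD coef1 coef_gen_poly.
    by rewrite gtn_eqF ?ifF ?addr0 ?mulr0 //; lia.
  rewrite (big_cat_nat (n := half.+1)) //=; last by lia.
  rewrite [X in _ + X]big_nat_cond [X in _ + X]big1 ?addr0 => [|i]; last first.
    rewrite andbT => /andP[lei _]; rewrite [T`__]coefD coef1 coef_gen_poly.
    by rewrite gtn_eqF ?ifF ?addr0 ?mul0r //; lia.
  apply: eq_big_nat => i ih; rewrite !coefD !coef1 !coef_gen_poly.
  have [i0 i1] : (0 < i)%N /\ (0 < M - i)%N by lia.
  have [i2 i3] : (i <= half)%N /\ (M - i <= k)%N by lia.
  by rewrite i0 i1 i2 i3 !gtn_eqF ?add0r.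
rewrite (@sum_pair (fun i => normal_coord x i * normal_coord x (M - i)%N)); last first.
  by move=> i lei; rewrite mulrC subKn// /M; lia.
(* Here v_i = t_i and v_(M-i) = u_(M-i) - G_i, the shift being taken at the partner index. *)
have -> : \sum_(n.+1 <= i < half.+1) normal_coord x i * normal_coord x (M - i)%N =
  \sum_(n.+1 <= i < half.+1) t i * x (M - i)%N -
  \sum_(n.+1 <= i < half.+1) t i * log_quot M i (t i) (gen_poly i.-1 t).
  rewrite -sumrB; apply: eq_big_nat => i ih; rewrite -mulrBr.
  have mi : middle i = false by rewrite /middle; apply/negP => /andP[_]; lia.
  have mi' : middle (M - i) = false.
    by rewrite /middle; apply/negP => /andP[/ho]; lia.
  rewrite /normal_coord /coord_scale /coord_shift mi mi'.
  have -> : (M - (M - i) = i)%N by rewrite /M; lia.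
  have -> : (i <= n)%N = false by lia.
  have -> : (M - i <= n)%N = false by rewrite /M; lia.
  have -> : (i <= half)%N by lia.
  have -> : (M - i <= half)%N = false.
    by rewrite /M; case: (boolP (odd (n + k))) => [/ho|/he]; lia.
  by rewrite !mul1r.
have -> : normal_coord x half.+1 * normal_coord x (M - half.+1)%N *+ odd (n + k) =
   - ((T * U)`_half.+1 ^+ 2 *+ odd (n + k)).
  case: (boolP (odd (n + k))) => od; last by rewrite !mulr0n oppr0.
  have -> : (M - half.+1 = half.+1)%N by move: (ho od); lia.
  have mi : middle half.+1 by rewrite /middle od eqxx.
  rewrite /normal_coord /coord_scale /coord_shift mi -/t -/T ltnn.
  rewrite [(half < n)%N]ltnNge nh /=.
  have -> : x half.+1 + (T * (1 + gen_poly half x))`_half.+1 = (T * U)`_half.+1.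
    (* The second summand starts in degree [half.+1], where it meets only the constant term 1 of T
       and gives [x half.+1]. *)
    have -> : U = (1 + gen_poly half x) + (gen_poly k x - gen_poly half x).
      by rewrite /U; ring.
    rewrite [T * (_ + (_ - _))]mulrDr [RHS]coefD [RHS]addrC; congr (_ + _).
    rewrite coefM big_ord_recl big1 => [|i _]; last first.
      rewrite coefB !coef_gen_poly.
      have -> : ((0 < half.+1 - bump 0 i <= k) = (0 < half.+1 - bump 0 i <= half))%N.
        by rewrite /bump /=; lia.
      by rewrite subrr mulr0.
    rewrite addr0 subn0 [T`__]coefD coef1 gen_poly0 addr0 mul1r.
    by rewrite coefB !coef_gen_poly ltnn subr0 ifT.
  by rewrite !mulr1n mulrACA -!expr2 sqrCi mulN1r.
rewrite low => E; rewrite mulr2n.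
set L := log_coef M (gen_poly k x) in E *.
set a := log_coef M (gen_poly n t) in E *.
set S1 := \sum_(_ <= _ < _) _ * x _ in E *.
set S2 := \sum_(_ <= _ < _) _ in E *.
set q := (_ ^+ 2) *+ _ in E *.
have -> : L = S1 - 2^-1 * q - (a + S2) by rewrite E; ring.
by field.
Qed.

Lemma normal_coord_0 i : (0 < i <= k)%N -> normal_coord (fun=> 0) i = 0.
Proof.
move=> /andP[i0 ik]; rewrite /normal_coord.
case: leqP => lei; first by rewrite rec_coef_0 ?mulr0.
have G0 l t : (forall a, (0 < a <= l)%N -> t a = 0) -> gen_poly l t = 0.
  by move=> t0; apply/polyP => a; rewrite coef_gen_poly coef0; case: ifP => // /t0.
have t0 a : (0 < a)%N -> rec_coef half (fun=> 0 : C) a = 0 by exact: rec_coef_0.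
rewrite /coord_shift !G0 => [|a /andP[a0 _]|//|a /andP[a0 _]]; rewrite ?t0//.
  rewrite add0r; case: ifP => _; first by rewrite addr0 mulr1 coef1 gtn_eqF// mulr0.
  by rewrite log_quot0 ?oppr0 ?mulr0//; lia.
lia.
Qed.

End NormalForm.

(** * Evaluation of the formal potential at a point *)

Lemma meval_Wpot (C : numFieldType) (k N : nat) (x : nat -> C) :
  meval (fun i : 'I_k => x i.+1) (Wpot C k N) = log_coef N.+1 (gen_poly k x).
Proof.
rewrite /Wpot /coef_ln1p rmorph_sum /= /log_coef; apply: eq_bigr => n _.
rewrite mevalZ -coef_map rmorphXn /=; set p := map_poly _ _.
suff -> : p = gen_poly k x by [].
rewrite /p rmorph_sum /=; apply/polyP => i; rewrite coef_sum coef_gen_poly.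
under eq_bigr => l _.
  rewrite rmorphM /= map_polyC /= map_polyXn mevalXU coefCM coefXn.
  over.
case: i => [|i] /=; first by rewrite big1// => l _; rewrite mulr0.
case: ltnP => ik; last first.
  by rewrite big1// => l _; rewrite gtn_eqF ?mulr0// ltnS (leq_trans _ ik).
rewrite (bigD1 (Ordinal ik)) //= eqxx mulr1 big1 ?addr0// => l.
by rewrite -val_eqE /= eqSS eq_sym => /negbTE ->; rewrite mulr0.
Qed.

(** * Differentiability of polynomial expressions *)

Section PolynomialMaps.
Variables (C : numFieldType) (V : normedModType C).
Implicit Types (f g : V -> C) (p q : V -> {poly C}) (x : V -> nat -> C).

Definition everywhere_diff f : Prop := forall u, differentiable f u.

(** Differentiability is taken coefficientwise, so that no topology on polynomials enters. *)
Definition coefs_diff p : Prop := forall i, everywhere_diff (fun u => (p u)`_i).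

Lemma everywhere_diff_cst (c : C) : everywhere_diff (fun=> c).
Proof. by move=> u; exact: differentiable_cst. Qed.

Lemma everywhere_diffD f g : everywhere_diff f -> everywhere_diff g ->
  everywhere_diff (fun u => f u + g u).
Proof. by move=> df dg u; exact: differentiableD. Qed.

Lemma everywhere_diffM f g : everywhere_diff f -> everywhere_diff g ->
  everywhere_diff (fun u => f u * g u).
Proof. by move=> df dg u; exact: differentiableM. Qed.

Lemma everywhere_diffN f : everywhere_diff f -> everywhere_diff (fun u => - f u).
Proof. by move=> df u; exact: differentiableN. Qed.

Lemma everywhere_diff_sum (I : Type) (r : seq I) (F : I -> V -> C) :
  (forall i, everywhere_diff (F i)) ->
  everywhere_diff (fun u => \sum_(i <- r) F i u).
Proof.
move=> dF; elim: r => [|a r IH].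
  by under eq_fun do rewrite big_nil; exact: everywhere_diff_cst.
by under eq_fun do rewrite big_cons; exact: everywhere_diffD.
Qed.

Lemma coefs_diff_cst (c : {poly C}) : coefs_diff (fun=> c).
Proof. by move=> i; exact: everywhere_diff_cst. Qed.

Lemma coefs_diffD p q : coefs_diff p -> coefs_diff q ->
  coefs_diff (fun u => p u + q u).
Proof.
by move=> dp dq i; under eq_fun do rewrite coefD; exact: everywhere_diffD.
Qed.

Lemma coefs_diffN p : coefs_diff p -> coefs_diff (fun u => - p u).
Proof. by move=> dp i; under eq_fun do rewrite coefN; exact: everywhere_diffN. Qed.

Lemma coefs_diffZ f p : everywhere_diff f -> coefs_diff p ->
  coefs_diff (fun u => f u *: p u).
Proof.
by move=> df dp i; under eq_fun do rewrite coefZ; exact: everywhere_diffM.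
Qed.

Lemma coefs_diffM p q : coefs_diff p -> coefs_diff q ->
  coefs_diff (fun u => p u * q u).
Proof.
move=> dp dq i; under eq_fun do rewrite coefM.
by apply: everywhere_diff_sum => l; exact: everywhere_diffM.
Qed.

Lemma coefs_diffX p n : coefs_diff p -> coefs_diff (fun u => p u ^+ n).
Proof.
move=> dp; elim: n => [|n IH]; first exact: coefs_diff_cst.
by under eq_fun do rewrite exprS; exact: coefs_diffM.
Qed.

Lemma coefs_diff_sum (I : Type) (r : seq I) (F : I -> V -> {poly C}) :
  (forall i, coefs_diff (F i)) -> coefs_diff (fun u => \sum_(i <- r) F i u).
Proof.
move=> dF i; under eq_fun do rewrite coef_sum.
by apply: everywhere_diff_sum => l; exact: dF.
Qed.

Lemma coefs_diff_gen_poly n x : (forall i, everywhere_diff (fun u => x u i)) ->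
  coefs_diff (fun u => gen_poly n (x u)).
Proof.
move=> dx i; under eq_fun do rewrite coef_gen_poly.
by case: (_ && _); [exact: dx | exact: everywhere_diff_cst].
Qed.

Lemma rec_coef_diff m x i : (forall i, everywhere_diff (fun u => x u i)) ->
  everywhere_diff (fun u => rec_coef m (x u) i).
Proof.
move=> dx; apply: coefs_diff_sum => l; apply: coefs_diffX; apply: coefs_diffN.
exact: coefs_diff_gen_poly.
Qed.

(** Since [log_quot] does not divide by its argument, zeros of [f] cause no singularity. *)
Lemma log_quot_diff M i f p : everywhere_diff f -> coefs_diff p ->
  everywhere_diff (fun u => log_quot M i (f u) (p u)).
Proof.
move=> df dp; apply: everywhere_diff_sum => n.
apply: everywhere_diffM; first exact: everywhere_diff_cst.
apply: coefs_diffM; first exact: coefs_diff_cst.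
apply: coefs_diff_sum => l; apply: coefs_diffM; apply: coefs_diffX => //.
by apply: coefs_diffD => //; apply: coefs_diffZ => //; exact: coefs_diff_cst.
Qed.

End PolynomialMaps.

(** * Holomorphy of the change of coordinates and its inverse *)

Section NormalFormDiff.
Variables (C : numClosedFieldType) (V : normedModType C) (n k : nat) (zeta : C).
Variable x : V -> nat -> C.
Hypothesis dx : forall i, everywhere_diff (fun u => x u i).

Lemma coord_shift_diff i : everywhere_diff (fun u => coord_shift n k (x u) i).
Proof.
rewrite /coord_shift; case: middle.
  by apply: coefs_diffM; apply: coefs_diffD;
    (exact: coefs_diff_cst || apply: coefs_diff_gen_poly => // l; exact: rec_coef_diff).
apply: everywhere_diffN; apply: log_quot_diff; first exact: rec_coef_diff.
by apply: coefs_diff_gen_poly => l; exact: rec_coef_diff.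
Qed.

Lemma normal_coord_diff i :
  everywhere_diff (fun u => normal_coord n k zeta (x u) i).
Proof.
rewrite /normal_coord; apply: everywhere_diffM; first exact: everywhere_diff_cst.
case: leqP => _; first exact: rec_coef_diff.
by apply: everywhere_diffD => //; exact: coord_shift_diff.
Qed.

End NormalFormDiff.

Lemma normal_coord_inv_diff (C : numClosedFieldType) (V : normedModType C)
    (n k : nat) (zeta : C) (v : V -> nat -> C) i :
  (forall i, everywhere_diff (fun u => v u i)) ->
  everywhere_diff (fun u => normal_coord_inv n k zeta (v u) i).
Proof.
move=> dv; have ds l : everywhere_diff (fun u => v u l / coord_scale n k zeta l).
  by apply: everywhere_diffM => //; exact: everywhere_diff_cst.
rewrite /normal_coord_inv; case: leqP => _; first exact: rec_coef_diff.
apply: everywhere_diffD => //; apply: everywhere_diffN.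
by apply: coord_shift_diff => l; exact: rec_coef_diff.
Qed.

(** * From maps of sequences to maps of C^k *)

Lemma coord1_diff (C : numFieldType) (k i : nat) :
  everywhere_diff (fun u : 'rV[C]_k => coord1 u i).
Proof.
rewrite /coord1; case: insub => [l|]; last exact: everywhere_diff_cst.
by move=> u; exact: differentiable_coord.
Qed.

Definition row_map (C : numFieldType) (k : nat) (f : (nat -> C) -> nat -> C)
    (u : 'rV[C]_k) : 'rV[C]_k := \row_(i < k) f (coord1 u) i.+1.

Lemma coord1_ord (C : fieldType) (k : nat) (u : 'rV[C]_k) (i : 'I_k) :
  coord1 u i.+1 = u 0 i.
Proof. by rewrite /coord1 /= insubT //= => lt; congr (u 0 _); exact/val_inj. Qed.

Lemma coord1_row_map (C : numFieldType) (k : nat) f (u : 'rV[C]_k) i :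
  (0 < i <= k)%N -> coord1 (row_map f u) i = f (coord1 u) i.
Proof.
case: i => // i ik; rewrite /coord1 /= insubT //= mxE.
by congr (f _ _).
Qed.

Lemma differentiable_row_map (C : numFieldType) (k : nat) f :
  (forall i, everywhere_diff (fun u : 'rV[C]_k => f (coord1 u) i)) ->
  forall u, differentiable (@row_map C k f) u.
Proof.
move=> df u.
(* Expansion in the standard basis reduces the claim to the scalar components. *)
have -> : @row_map C k f =
    \sum_(i < k) (fun u => f (coord1 u) i.+1 *: delta_mx 0 i).
  apply/funext => w; rewrite fct_sumE /row_map [LHS]row_sum_delta.
  by apply: eq_bigr => i _; rewrite mxE.
by apply: differentiable_sum => i; apply: differentiableZl; exact: df.
Qed.

(** * The biholomorphism of C^k *)

Theorem mainTheorem2 (R : realType) (k j : nat)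
    (hk : (1 <= k)%N) (hj : (1 <= j <= k)%N) :
  exists (U V : set 'rV[R[i]]_k) (phi : 'rV[R[i]]_k -> 'rV[R[i]]_k),
    [/\ U 0, phi 0 = 0, biholomorphism U V phi &
      forall u, U u ->
        let v := coord1 (phi u) in
        meval (fun i : 'I_k => coord1 u i.+1) (Wpot R[i] k (2 * k - j))
        = meval (fun i : 'I_(k - j) => v i.+1) (Wpot R[i] (k - j) (2 * k - j))
          + 2^-1 * \sum_(1 <= s < j.+1) v (k - j + s)%N * v (k + 1 - s)%N].
Proof.
pose n := (k - j)%N; have nk : (n < k)%N by lia.
pose zeta : R[i] := (n + k).+1.-root (-1).
have zetaM : zeta ^+ (n + k).+1 = -1 by exact: rootCK.
pose phi := @row_map R[i] k (normal_coord n k zeta).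
pose psi := @row_map R[i] k (normal_coord_inv n k zeta).
have phiK : cancel phi psi.
  move=> u; apply/rowP => i; rewrite mxE.
  rewrite (eq_normal_coord_inv _ nk (w := normal_coord n k zeta (coord1 u)));
    rewrite ?ltn_ord//; last by move=> l lk; exact: coord1_row_map.
  by rewrite normal_coordK// coord1_ord.
have psiK : cancel psi phi.
  move=> u; apply/rowP => i; rewrite mxE.
  rewrite (eq_normal_coord _ nk (y := normal_coord_inv n k zeta (coord1 u)));
    rewrite ?ltn_ord//; last by move=> l lk; exact: coord1_row_map.
  by rewrite normal_coord_invK// coord1_ord.
(* [phi] and [psi] are mutually inverse and everywhere differentiable, so both neighbourhoods can be
   the whole space. *)
exists setT, setT, phi; split; first exact: I.
- apply/rowP => i; rewrite !mxE.
  rewrite (eq_normal_coord _ nk (y := fun=> 0)) ?ltn_ord// => [|[|l] // lk].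
    by rewrite normal_coord_0// ltn_ord.
  by rewrite (coord1_ord 0 (Ordinal lk)) mxE.
- split.
  + split=> [u _|u v _ _ E|v _]; first exact: I.
      exact: can_inj phiK _ _ E.
    by exists (psi v); [exact: I | exact: psiK].
  + split; first exact: openT.
    move=> u _; apply: differentiable_row_map => i.
    by apply: normal_coord_diff => l; exact: coord1_diff.
  + exists psi; [by move=> u _; exact: phiK | split]; first exact: openT.
    move=> u _; apply: differentiable_row_map => i.
    by apply: normal_coord_inv_diff => l; exact: coord1_diff.
- move=> u _ v.
have vE i : (0 < i <= k)%N -> v i = normal_coord n k zeta (coord1 u) i.
  exact: coord1_row_map.
rewrite !meval_Wpot -/n; have -> : ((2 * k - j).+1 = (n + k).+1)%N by lia.
rewrite (log_coef_normal_form nk zetaM (coord1 u)).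
rewrite (eq_gen_poly (y := v)) => [|i ik]; last by rewrite vE//; lia.
congr (_ + _ * _).
(* Substituting i = n + s turns the index k + 1 - s into M - i. *)
have -> : (j.+1 = k.+1 - n)%N by lia.
rewrite -add1n big_addn; apply: eq_big_nat => s sj.
rewrite addnC !vE; try lia.
by congr (_ * normal_coord _ _ _ _ _); lia.
Qed.
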